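(* With $\alpha=1+\sqrt2$ and $\beta=1-\sqrt2$, for all $n\geq 1$: $$B_{n}^{neobc}=\frac{3(\alpha^{4n-1}+\beta^{4n-1})+6}{8},\quad C_{n}^{neobc}=\frac{3(\alpha^{4n-1}-\beta^{4n-1})}{2\sqrt{2}},$$ $$R_{n}^{neobc}=\frac{3(\alpha^{4n-2}+\beta^{4n-2})-10}{8},\quad CR_{n}^{neobc}=\frac{3(\alpha^{4n-2}-\beta^{4n-2})}{4\sqrt{2}}.$$
   Context: A positive integer $m$ is a neo balcobalancing number if there is a positive integer $r$ (its neo balcobalancer) such that $(1+2+\cdots+(m-1))+(1+2+\cdots+m)=2[(m-1)+m+(m+1)+(m+2)+\cdots+(m+r)]$; then $r=\frac{-2m-1+\sqrt{8m^2-12m+9}}{2}$ (equivalently, $m$ is a neo balcobalancing number iff $8m^2-12m+9$ is a perfect square). $B_n^{neobc}$ denotes the $n$-th neo balcobalancing number in increasing order ($n\ge1$), $R_n^{neobc}$ its neo balcobalancer, $C_n^{neobc}=\sqrt{8(B_n^{neobc})^2-12B_n^{neobc}+9}$ and $CR_n^{neobc}=\sqrt{2(R_n^{neobc})^2+5R_n^{neobc}+2}$. *)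

(* Defs.v *)
From mathcomp Require Import all_boot all_order all_algebra.
From mathcomp Require Import boolp classical_sets reals.

Set Implicit Arguments.
Unset Strict Implicit.
Unset Printing Implicit Defensive.

Import Order.TTheory GRing.Theory Num.Theory.

Definition neo_balcobalancer (m r : nat) : Prop :=
  [/\ (0 < m)%N, (0 < r)%N &
    (\sum_(1 <= i < m) i + \sum_(1 <= i < m.+1) i =
     2 * \sum_(m.-1 <= i < (m + r).+1) i)%N].

Definition neo_balcobalancing (m : nat) : Prop :=
  exists r : nat, neo_balcobalancer m r.

(* m is the n-th neo balcobalancing number in increasing order (1-based): it is
   one, and exactly n of them lie in {1, ..., m}. *)
Definition nth_neo_balcobalancing (n m : nat) : Prop :=
  neo_balcobalancing m /\
  count (fun k => `[< neo_balcobalancing k >]) (iota 1 m) = n.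

(* Definite descriptions; the junk value 0 is neither a neo balcobalancing
   number nor a neo balcobalancer. *)
Definition Bneobc (n : nat) : nat :=
  xget 0%N [set m | nth_neo_balcobalancing n m]%classic.

Definition Rneobc (n : nat) : nat :=
  xget 0%N [set r | neo_balcobalancer (Bneobc n) r]%classic.

Local Open Scope ring_scope.

Definition Cneobc (R : realType) (n : nat) : R :=
  Num.sqrt (8 * (Bneobc n)%:R ^+ 2 - 12 * (Bneobc n)%:R + 9).

Definition CRneobc (R : realType) (n : nat) : R :=
  Num.sqrt (2 * (Rneobc n)%:R ^+ 2 + 5 * (Rneobc n)%:R + 2).

(* Main.v *)
Require Import Defs.
From mathcomp Require Import all_boot all_order all_algebra.
From mathcomp Require Import boolp classical_sets reals.
From mathcomp Require Import zify ring lra.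
Import Order.TTheory GRing.Theory Num.Theory.
Local Open Scope ring_scope.

(** With [s = m + r], the defining equation of a neo balcobalancer becomes
    [2 m^2 - 3 m + 2 = s (s + 1)], that is [x^2 - 2 y^2 = -9] for [x = 4 m - 3]
    and [y = 2 s + 1].  Multiplying [x + y sqrt 2] by the unit
    [17 + 12 sqrt 2 = alpha^4] gives the map
    [(m, s) -> (17 m + 12 s - 6, 24 m + 17 s - 10)] on solutions.  Its inverse
    decreases [m] and keeps [m, s >= 0] as soon as [m >= 6], and [(0, 1)] is the
    only solution with [m < 6], so all solutions form the orbit of [(0, 1)],
    along which the closed forms follow by induction. *)

(** The truncated subtractions are exact as soon as [s > 0], which is why [neobc_orbit_spec] also
    carries positivity. *)
Definition neobc_step (p : nat * nat) : nat * nat :=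
  (17 * p.1 + 12 * p.2 - 6, 24 * p.1 + 17 * p.2 - 10)%N.

Definition neobc_orbit (k : nat) : nat * nat := iter k neobc_step (0, 1)%N.

Definition neobc_eqn (m s : nat) : Prop :=
  (2 * m * m + 2 = s * s + s + 3 * m)%N.

Lemma double_sum_nat (n : nat) : (2 * \sum_(0 <= i < n) i = n * n.-1)%N.
Proof.
elim: n => [|n IHn]; first by rewrite big_geq.
by rewrite big_nat_recr //= mulnDr IHn; case: n {IHn} => //= n; lia.
Qed.

Lemma double_sum_interval (a b : nat) : (a <= b)%N ->
  (2 * \sum_(a <= i < b) i + a * a.-1 = b * b.-1)%N.
Proof.
move=> leab; rewrite -!double_sum_nat (@big_cat_nat _ _ _ a 0%N b) //=.
by rewrite mulnDr addnC.
Qed.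

(** The left side of the defining equation is [m^2]; with [s = m + r], the right side is
    [s (s + 1) - (m - 1) (m - 2)]. *)
Lemma neo_balcobalancerE (m r : nat) :
  neo_balcobalancer m r <-> [/\ (0 < m)%N, (0 < r)%N & neobc_eqn m (m + r)].
Proof.
rewrite /neobc_eqn; split=> -[m0 r0 eqn]; split=> //; move: eqn;
  have := @double_sum_interval 1%N m m0;
  have := @double_sum_interval 1%N m.+1 isT;
  have := @double_sum_interval m.-1 (m + r).+1 ltac:(lia);
  move: (\sum_(_ <= i < _) i)%N (\sum_(_ <= i < _) i)%N
        (\sum_(_ <= i < _) i)%N => a b c;
  case: m m0 => // -[|m] _ /=; nia.
Qed.

Lemma neobc_eqn_inj (m s t : nat) : neobc_eqn m s -> neobc_eqn m t -> s = t.
Proof. by rewrite /neobc_eqn; nia. Qed.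

(** If [s <= m], the equation gives [m^2 + 2 <= 4 m], false for [m > 3]. This makes [r = s - m]
    positive. *)
Lemma neobc_eqn_gt (m s : nat) : (5 < m)%N -> neobc_eqn m s -> (m < s)%N.
Proof. by rewrite /neobc_eqn; nia. Qed.

Lemma neobc_eqn_small (m s : nat) :
  (m < 6)%N -> neobc_eqn m s -> (m, s) = (0, 1)%N.
Proof.
rewrite /neobc_eqn => m6 eqn.
have s7 : (s < 7)%N by nia.
by move: m6 s7 eqn; do 6?[case: m => [|m]]; do 7?[case: s => [|s]].
Qed.

Lemma neobc_step_eqn (m s : nat) : (0 < s)%N -> neobc_eqn m s ->
  neobc_eqn (neobc_step (m, s)).1 (neobc_step (m, s)).2.
Proof. by rewrite /neobc_eqn /neobc_step /=; nia. Qed.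

Lemma neobc_eqn_descent (m s : nat) : (5 < m)%N -> neobc_eqn m s ->
  exists p : nat * nat,
    [/\ (p.1 < m)%N, neobc_eqn p.1 p.2 & (m, s) = neobc_step p].
Proof.
move=> m6 eqn; have ms := @neobc_eqn_gt m s m6 eqn.
(* The inverse step is [(17 m - 12 s - 18, 17 s + 26 - 24 m)]: [lo] and [hs] keep its coordinates
   nonnegative, and [hi] makes the first one smaller than [m]. *)
have lo : (12 * s + 18 <= 17 * m)%N by move: eqn; rewrite /neobc_eqn; nia.
have hi : (16 * m < 12 * s + 18)%N by move: eqn; rewrite /neobc_eqn; nia.
have hs : (24 * m <= 17 * s + 26)%N by move: eqn; rewrite /neobc_eqn; nia.
exists (17 * m - (12 * s + 18), 17 * s + 26 - 24 * m)%N; split => /=.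
- by lia.
- by move: eqn; rewrite /neobc_eqn; nia.
- by rewrite /neobc_step /=; congr (_, _); lia.
Qed.

Lemma neobc_orbit_spec (k : nat) :
  (0 < (neobc_orbit k).2)%N /\ neobc_eqn (neobc_orbit k).1 (neobc_orbit k).2.
Proof.
elim: k => [//|k]; rewrite /neobc_orbit iterS -/(neobc_orbit k).
case: (neobc_orbit k) => m s /= [s0 eqn]; split; first by lia.
exact: neobc_step_eqn.
Qed.

Lemma neobc_eqn_orbit (m s : nat) :
  neobc_eqn m s -> exists k, (m, s) = neobc_orbit k.
Proof.
elim/ltn_ind: m s => m IHm s eqn.
have [m6|m6] := ltnP m 6; first by exists 0%N; apply: neobc_eqn_small.
have [[m' s'] [/= lt_m eqn' ->]] := @neobc_eqn_descent m s m6 eqn.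
by have [k ->] := IHm _ lt_m _ eqn'; exists k.+1.
Qed.

Lemma neobc_orbit_ltS (k : nat) : ((neobc_orbit k).1 < (neobc_orbit k.+1).1)%N.
Proof.
have [+ _] := neobc_orbit_spec k; rewrite /neobc_orbit iterS -/(neobc_orbit k).
by rewrite /=; lia.
Qed.

Lemma neobc_orbit_gt5 (k : nat) : (5 < (neobc_orbit k.+1).1)%N.
Proof. by elim: k => // k /ltn_trans; apply; apply: neobc_orbit_ltS. Qed.

(** The index is [k.+1] because the starting point [(0, 1)] has [m = 0]; all later points have
    [m > 5], hence [m < s]. *)
Lemma neo_balcobalancer_orbit (k r : nat) :
  neo_balcobalancer (neobc_orbit k.+1).1 r <->
  ((neobc_orbit k.+1).1 + r)%N = (neobc_orbit k.+1).2.
Proof.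
have [_ eqn] := neobc_orbit_spec k.+1.
have m6 := neobc_orbit_gt5 k.
have ms := @neobc_eqn_gt _ _ m6 eqn.
rewrite neo_balcobalancerE; split=> [[_ _ eqn']|e].
  exact: neobc_eqn_inj eqn' eqn.
by split; [lia | lia | rewrite e].
Qed.

Lemma neo_balcobalancingE (m : nat) :
  neo_balcobalancing m <-> exists k, m = (neobc_orbit k.+1).1.
Proof.
split=> [[r /neo_balcobalancerE [m0 r0 eqn]]|[k ->]].
  have [[|k] e] := @neobc_eqn_orbit _ _ eqn; first by case: e m0 => ->.
  by exists k; rewrite -e.
exists ((neobc_orbit k.+1).2 - (neobc_orbit k.+1).1)%N.
apply/neo_balcobalancer_orbit.
have [_ eqn] := neobc_orbit_spec k.+1.
by have := @neobc_eqn_gt _ _ (neobc_orbit_gt5 k) eqn; lia.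
Qed.

Lemma count_increasing_range (a : nat -> nat) (P : pred nat) :
  a 0%N = 0%N -> (forall k, (a k < a k.+1)%N) ->
  (forall m, reflect (exists k, m = a k.+1) (P m)) ->
  forall k, count P (iota 1 (a k)) = k.
Proof.
move=> a0 aS PP; have a_mono := leqW_mono (leq_mono (homo_ltn ltn_trans aS)).
elim=> [|k IHk]; first by rewrite a0.
(* Cut [1, ..., a k.+1] into [1, ..., a k], the gap strictly between the two values, and [a k.+1]
   itself; by monotonicity the gap contains no value of [a]. *)
have -> : a k.+1 = (a k + (a k.+1 - (a k).+1) + 1)%N by have := aS k; lia.
rewrite !iotaD !count_cat IHk /=.
have -> : (1 + (a k + (a k.+1 - (a k).+1)) = a k.+1)%N by have := aS k; lia.
have -> : P (a k.+1) by apply/PP; exists k.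
rewrite (_ : count P _ = 0%N) ?addn0 ?addn1 //; apply/eqP.
rewrite -leqn0 leqNgt -has_count; apply/negP => /hasP[m + /PP[j mE]].
rewrite mem_iota {}mE => /andP[lo hi].
have : (a k < a j.+1)%N by lia.
have : (a j.+1 < a k.+1)%N by have := aS k; lia.
by rewrite !a_mono; lia.
Qed.

Lemma nth_neo_balcobalancingE (k m : nat) :
  nth_neo_balcobalancing k.+1 m <-> m = (neobc_orbit k.+1).1.
Proof.
have cnt := @count_increasing_range (fun k => (neobc_orbit k).1)
  (fun m => `[< neo_balcobalancing m >]) erefl neobc_orbit_ltS
  (fun m => equivP (asboolP _) (neo_balcobalancingE m)).
split=> [[/neo_balcobalancingE[j ->]]|->].
  by rewrite cnt => -[->].
by split; [apply/neo_balcobalancingE; exists k | exact: cnt].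
Qed.

Lemma BneobcE (k : nat) : Bneobc k.+1 = (neobc_orbit k.+1).1.
Proof.
apply: xget_unique; first exact/nth_neo_balcobalancingE.
by move=> m /nth_neo_balcobalancingE.
Qed.

Lemma Bneobc_add_Rneobc (k : nat) :
  (Bneobc k.+1 + Rneobc k.+1)%N = (neobc_orbit k.+1).2.
Proof.
rewrite BneobcE; apply/neo_balcobalancer_orbit; rewrite /Rneobc BneobcE.
apply: (xgetPex 0%N); apply/neo_balcobalancingE; by exists k.
Qed.

(** Both formulas restate [(4 m - 3) + (2 s + 1) sqrt 2 = 3 alpha^(4k+3)] and its conjugate: the
    point [(6, 7)] gives [21 + 15 sqrt 2 = 3 alpha^3], and each step multiplies by [alpha^4]. *)
Lemma neobc_orbit_closed_form (R : realType) (k : nat) :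
  let alpha : R := 1 + Num.sqrt 2 in
  let beta : R := 1 - Num.sqrt 2 in
  (neobc_orbit k.+1).1%:R =
    (3 * (alpha ^+ (4 * k + 3) + beta ^+ (4 * k + 3)) + 6) / 8 /\
  2 * (neobc_orbit k.+1).2%:R + 1 =
    (3 * (alpha ^+ (4 * k + 3) - beta ^+ (4 * k + 3))) / (2 * Num.sqrt 2).
Proof.
have q2 : Num.sqrt 2 ^+ 2 = 2 :> R by rewrite sqr_sqrtr.
have q0 : Num.sqrt 2 != 0 :> R by rewrite sqrtr_eq0 -ltNge.
move: (Num.sqrt 2) q2 q0 => q q2 q0 alpha beta.
have alpha4 : alpha ^+ 4 = 17 + 12 * q by rewrite /alpha; ring: q2.
have beta4 : beta ^+ 4 = 17 - 12 * q by rewrite /beta; ring: q2.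
elim: k => [|k].
  have -> : neobc_orbit 1 = (6, 7)%N by [].
  by rewrite /alpha /beta /=; split; field: q2.
have [+ _] := neobc_orbit_spec k.+1.
rewrite [neobc_orbit k.+2]iterS -/(neobc_orbit k.+1).
case: (neobc_orbit k.+1) => m s /= s0.
have -> : (4 * k.+1 + 3 = 4 + (4 * k + 3))%N by lia.
rewrite !natrB ?natrD ?natrM; try lia.
move: (4 * k + 3)%N => e; rewrite !exprD alpha4 beta4.
move: (alpha ^+ _) (beta ^+ _) => x y [mE sE].
have {}sE : s%:R = (3 * (x - y) / (2 * q) - 1) / 2 by rewrite -sE; field.
by rewrite mE sE; split; field: q2.
Qed.

Theorem theorem3p1 (R : realType) (n : nat) (hn : (1 <= n)%N) :
  let alpha : R := 1 + Num.sqrt 2 in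
  let beta : R := 1 - Num.sqrt 2 in
  [/\ (Bneobc n)%:R =
        (3 * (alpha ^+ (4 * n - 1) + beta ^+ (4 * n - 1)) + 6) / 8,
      Cneobc R n =
        (3 * (alpha ^+ (4 * n - 1) - beta ^+ (4 * n - 1))) / (2 * Num.sqrt 2),
      (Rneobc n)%:R =
        (3 * (alpha ^+ (4 * n - 2) + beta ^+ (4 * n - 2)) - 10) / 8 &
      CRneobc R n =
        (3 * (alpha ^+ (4 * n - 2) - beta ^+ (4 * n - 2))) / (4 * Num.sqrt 2)].
Proof.
case: n hn => // k _ alpha beta.
have [] := neobc_orbit_closed_form R k; rewrite -/alpha -/beta.
have [_ eqn] := neobc_orbit_spec k.+1.
move: eqn; rewrite /Cneobc /CRneobc -Bneobc_add_Rneobc -BneobcE.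
move: (Bneobc _) (Rneobc _) => m r eqn.
have -> : (4 * k.+1 - 1 = 4 * k + 3)%N by lia.
have -> : (4 * k.+1 - 2 = 4 * k + 2)%N by lia.
have q2 : Num.sqrt 2 ^+ 2 = 2 :> R by rewrite sqr_sqrtr.
have q0 : 0 < Num.sqrt 2 :> R by rewrite sqrtr_gt0.
have qn0 : Num.sqrt 2 != 0 :> R by rewrite gt_eqF.
(* Factor out one [alpha] and one [beta], so that all four formulas are expressed in the powers of
   exponent [4k+2]. *)
rewrite [(4 * k + 3)%N]addnS !exprS => mE sE.
(* This settles the sign of the square root in [CRneobc]. The exponent is even, so it suffices that
   [beta^2 <= alpha^2]. *)
have le_pow : beta ^+ (4 * k + 2) <= alpha ^+ (4 * k + 2).
  have -> : (4 * k + 2 = 2 * (2 * k + 1))%N by lia.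
  rewrite !exprM lerXn2r ?nnegrE ?sqr_ge0 //.
  by rewrite /alpha /beta; move: q0; move: (Num.sqrt 2) => q; nra.
have prod_pow : alpha ^+ (4 * k + 2) * beta ^+ (4 * k + 2) = 1.
  have -> : (4 * k + 2 = 2 * (2 * k + 1))%N by lia.
  rewrite -exprMn exprM.
  have -> : alpha * beta = -1 by rewrite /alpha /beta; ring: q2.
  by rewrite sqrrN !expr1n.
move: mE sE; rewrite {}/alpha {}/beta in le_pow prod_pow *.
move: (_ ^+ (4 * k + 2)) (_ ^+ (4 * k + 2)) le_pow prod_pow => x y.
move: (Num.sqrt 2) q2 q0 qn0 => q q2 q0 qn0 le_xy xy1 mE sE.
have rE : r%:R = (3 * (x + y) - 10) / 8 :> R.
  have {}sE : r%:R = (3 * ((1 + q) * x - (1 - q) * y) / (2 * q) - 1) / 2 - m%:R.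
    by rewrite -sE natrD; field.
  by rewrite sE mE; field: q2.
split=> //.
(* The equation for [s = m + r] says that [8 m^2 - 12 m + 9 = (2 s + 1)^2]. *)
- rewrite -sE (_ : _ + 9 = (2 * (m + r)%:R + 1) ^+ 2).
    by rewrite sqrtr_sqr ger0_norm // addr_ge0 // mulr_ge0.
  have : (2 * m * m + 2)%:R = ((m + r) * (m + r) + (m + r) + 3 * m)%:R :> R.
    by rewrite eqn.
  by rewrite !(natrD, natrM); lra.
(* Since [8 (2 r^2 + 5 r + 2) = (4 r + 5)^2 - 9] and [4 r + 5 = 3 (x + y) / 2], the relation
   [x y = 1] turns [(x + y)^2 - 4] into [(x - y)^2]. *)
- rewrite (_ : _ + 2 = (3 * (x - y) / (4 * q)) ^+ 2).
    rewrite sqrtr_sqr ger0_norm // divr_ge0 ?mulr_ge0 ?subr_ge0 //.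
    exact: ltW.
  by rewrite rE; field: q2 xy1.
Qed.
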